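(* Let $\mathcal A\subseteq\mathbb Z_{>0}$ be a nonempty set and $B_{\mathcal A}(z)=\sum_{a\in\mathcal A}z^a$. Assume that, for some $\rho\in(0,1)$, $B_{\mathcal A}(z)$ is analytic in a disk (centered at $0$) of radius strictly larger than $\rho$, that $B_{\mathcal A}(\rho)=1$, and that $\gcd(\mathcal A)=1$. Then $\rho$ is the unique dominant zero (unique zero of smallest modulus) of $1-B_{\mathcal A}(z)$ and $$t_{\mathcal A}(n)\sim\frac{\rho^{-n-1}}{B'_{\mathcal A}(\rho)}\qquad(n\to\infty).$$ Consequently, for fixed $p\in\mathcal A$ and $k\ge1$, $$\mathbb P(P_n=p,K_n=k)\longrightarrow\rho^{pk}(1-\rho^p)\qquad(n\to\infty).$$ The marginals of the limiting law $(P,K)$ satisfy $$\mathbb P(P=p)=\rho^p\quad(p\in\mathcal A),\qquad \mathbb P(K\ge k)=B_{\mathcal A}(\rho^k)\quad(k\ge1),$$ and the limiting total size $S=PK$ has distribution $$\mathbb P(S=s)=\rho^s\sum_{\substack{d\mid s\\ d\in\mathcal A}}(1-\rho^d)\qquad(s\ge1).$$ Moreover, for each fixed integer $r\ge1$, $$\lim_{n\to\infty}\mathbb E[S_n^r]=\sum_{m\ge1}A_{r,\mathcal A}(m)\rho^m$$ whenever the displayed series is finite.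
   Context: An integer composition of $n\ge1$ is an ordered sequence $\alpha=(a_1,\ldots,a_\ell)$ of integers $a_i\ge1$ with sum $n$. The initial run of $\alpha$ is the maximal prefix $(a_1,\ldots,a_k)$ whose entries are all equal; $P(\alpha)=a_1$, $K(\alpha)=k$ is the number of parts in it, and $S(\alpha)=P(\alpha)K(\alpha)$. $T_{\mathcal A}(z)=\frac{1}{1-B_{\mathcal A}(z)}$ and $t_{\mathcal A}(n)=[z^n]T_{\mathcal A}(z)$ is the number of compositions of $n$ with all parts in $\mathcal A$ (the empty composition being counted for $n=0$). For $n\ge1$ with $t_{\mathcal A}(n)>0$ (which holds for all large $n$), $\alpha_n$ is uniformly distributed on the compositions of $n$ with all parts in $\mathcal A$, and $P_n=P(\alpha_n)$, $K_n=K(\alpha_n)$, $S_n=S(\alpha_n)$. $(P,K)$ denotes a pair with the joint law $\mathbb P(P=p,K=k)=\lim_{n\to\infty}\mathbb P(P_n=p,K_n=k)$, $p\in\mathcal A$, $k\ge1$. For $r\ge1$, $A_{r,\mathcal A}(n)=\sum_{d\mid n,\ d\in\mathcal A}\bigl(n^r-(n-d)^r\bigr)$. *)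

(* Defs.v *)
From HB Require Import structures.
From mathcomp Require Import all_boot all_order all_algebra finmap.
From mathcomp Require Import all_classical all_reals all_analysis.
From mathcomp Require Import complex.

Set Implicit Arguments.
Unset Strict Implicit.
Unset Printing Implicit Defensive.

Import Order.TTheory GRing.Theory Num.Theory numFieldNormedType.Exports.

Local Open Scope classical_set_scope.
Local Open Scope ring_scope.

Definition is_composition (n : nat) (s : seq nat) : Prop :=
  (forall a, a \in s -> (0 < a)%N) /\ sumn s = n.

Definition compositions (A : set nat) (n : nat) : set (seq nat) :=
  [set s | is_composition n s /\ (forall a, a \in s -> A a)].

(* [fset_set X] is the finite set underlying [X] only when [X] is finite; this
   is the case here, see [finite_compositions] below. *)
Definition ncomp (A : set nat) (n : nat) : nat :=
  #|` fset_set (compositions A n)|%fset.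

Definition first_part (s : seq nat) : nat := head 0%N s.

(* [find] returns the index of the first part that differs from the first one,
   and [size s] when there is none. *)
Definition run_length (s : seq nat) : nat :=
  find (fun a => a != first_part s) s.

Definition run_total (s : seq nat) : nat := (first_part s * run_length s)%N.

(* The uniform law is only meaningful when [ncomp A n > 0]; otherwise division
   by zero makes [comp_prob] and [comp_expect] equal to [0]. *)

Definition comp_prob (R : realType) (A : set nat) (n : nat)
    (E : set (seq nat)) : R :=
  #|` fset_set (compositions A n `&` E)|%fset%:R / (ncomp A n)%:R.

Definition comp_expect (R : realType) (A : set nat) (n : nat)
    (f : seq nat -> R) : R :=
  (\sum_(s <- fset_set (compositions A n)) f s) / (ncomp A n)%:R.

Definition limit_pmf (R : realType) (A : set nat) (p k : nat) : R :=
  limn (fun n =>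
    comp_prob R A n [set s | first_part s = p /\ run_length s = k]).

(* Probability that the limiting pair (P, K), whose mass function on the pairs
   (p, k) with p in A and k >= 1 is [limit_pmf], falls in [E]. *)
Definition limit_prob (R : realType) (A : set nat) (E : set (nat * nat)) :
    \bar R :=
  \esum_(x in E `&` [set x | A x.1 /\ (0 < x.2)%N]) (limit_pmf R A x.1 x.2)%:E.

(* [K^o] carries the topology of the norm; [K] will be [R] or [R[i]].  Outside
   the domain of convergence the value is a meaningless default. *)
Definition Bseries (K : numFieldType) (A : set nat) (z : K) : nat -> K^o :=
  series (fun n => (n \in A)%:R * z ^+ n : K^o).

Definition B (K : numFieldType) (A : set nat) (z : K) : K :=
  limn (Bseries A z).

Definition analytic_at (K : numFieldType) (f : K -> K) (z : K) : Prop :=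
  exists (c : nat -> K) (e : K), 0 < e /\
    forall w : K, `|w - z| < e ->
      (series (fun n => c n * (w - z) ^+ n : K^o) : nat -> K^o) @ \oo
        --> (f w : K^o).

Definition unique_dominant_zero (K : numFieldType) (D : set K) (f : K -> K)
    (z0 : K) : Prop :=
  [/\ D z0, f z0 = 0 &
      forall z, D z -> f z = 0 -> z <> z0 -> `|z0| < `|z|].

Definition divisor_sum (R : realType) (A : set nat) (r n : nat) : R :=
  \sum_(d <- divisors n | d \in A) (n%:R ^+ r - (n%:R - d%:R) ^+ r).

Lemma compositions0 (A : set nat) : compositions A 0 = [set [::]].
Proof.
apply/seteqP; split=> [[|a s] //=|s ->]; last by split; [split|].
by case=> -[/(_ a (mem_head _ _)) a0 /eqP]; rewrite addn_eq0 -leqn0 leqNgt a0.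
Qed.

Lemma compositions_cons (A : set nat) (n a : nat) (s : seq nat) :
  compositions A n (a :: s) <->
  [/\ (0 < a <= n)%N, A a & compositions A (n - a) s].
Proof.
split=> [[[pos /= <-] inA]|[/andP[a0 an] Aa [[pos sE] inA]]].
  split; first by rewrite pos ?mem_head//= leq_addr.
    exact/inA/mem_head.
  split; last by move=> b bs; apply: inA; rewrite inE bs orbT.
  by split=> [b bs|]; [apply: pos; rewrite inE bs orbT|rewrite addKn].
split; last by move=> b; rewrite inE => /predU1P[->|/inA].
split; last by rewrite /= sE subnKC.
by move=> b; rewrite inE => /predU1P[->|/pos].
Qed.

Lemma finite_compositions (A : set nat) (n : nat) :
  finite_set (compositions A n).
Proof.
elim/ltn_ind: n => n IHn.
case: n IHn => [|n] IHn; first by rewrite compositions0; exact: finite_set1.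
apply: (@sub_finite_set _ _
  (\bigcup_(a in `I_n.+1) ((cons a.+1) @` compositions A (n.+1 - a.+1)))).
  case=> [[] []//|a s] /compositions_cons[/andP[a0 an] _ cs].
  by exists a.-1; rewrite /= ?prednK//; exists s; rewrite // prednK.
apply: bigcup_finite => [|a _]; first exact: finite_II.
by apply/finite_image/IHn; rewrite subSS ltnS leq_subr.
Qed.

(* T = 1 + B T coefficientwise, that is, [ncomp A] is the coefficient sequence
   of the formal power series T = 1 / (1 - B). *)
Lemma ncomp_genfun (A : set nat) (n : nat) : ~ A 0%N ->
  ncomp A n = ((n == 0%N) + \sum_(a < n.+1 | (a : nat) \in A) ncomp A (n - a))%N.
Proof.
move=> A0; case: n => [|n].
  rewrite /ncomp compositions0 fset_set1 cardfs1 big1 ?addn0// => i.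
  by rewrite ord1 => /set_mem/A0.
rewrite add0n /ncomp.
pose X m : seq (seq nat) := fset_set (compositions A m).
pose L := [seq a :: s | a <- [seq a <- iota 0 n.+2 | a \in A], s <- X (n.+1 - a)%N].
have memX m s : (s \in X m) = (s \in compositions A m).
  by rewrite in_fset_set//; exact: finite_compositions.
have /perm_size -> : perm_eq (X n.+1) L.
  apply: uniq_perm; first exact: fset_uniq.
    apply: allpairs_uniq_dep; first by rewrite filter_uniq// iota_uniq.
      by move=> a _; exact: fset_uniq.
    by move=> [a s] [b t] _ _ /= [-> ->].
  move=> s; rewrite memX; apply/idP/idP.
    rewrite inE; case: s => [[] []//|a s] /compositions_cons[/andP[a0 an] Aa cs].
    apply/allpairsPdep; exists a, s; split=> //; last by rewrite memX inE.
    by rewrite mem_filter mem_iota mem_set//= ltnS.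
  move=> /allpairsPdep[a [t [+ + ->]]].
  rewrite mem_filter mem_iota memX => /andP[/set_mem Aa /= an] /set_mem ct.
  apply/mem_set.
  apply/compositions_cons; split=> //; rewrite -(ltnS a) an andbT lt0n.
  by apply/eqP => a0; apply: A0; rewrite -a0.
rewrite size_allpairs_dep sumnE big_map big_filter.
by rewrite -[iota 0 n.+2]/(index_iota 0 n.+2) big_mkord.
Qed.

(* Main.v *)
Require Import Defs.
From HB Require Import structures.
From mathcomp Require Import all_boot all_order all_algebra finmap.
From mathcomp Require Import all_classical all_reals all_analysis.
From mathcomp Require Import complex.
From mathcomp Require Import ring lra zify.

Set Implicit Arguments.
Unset Strict Implicit.
Unset Printing Implicit Defensive.

Import Order.TTheory GRing.Theory Num.Theory numFieldNormedType.Exports.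

Local Open Scope classical_set_scope.
Local Open Scope complex_scope.
Local Open Scope ring_scope.

(** Put u(n) = t(n) rho^n, where t(n) counts the compositions of n with parts
    in A. Splitting off the first part gives t = 1 / (1 - B) on coefficients,
    so u is a renewal sequence: u(n) is the sum of f(k) u(n - k), where
    f(k) = rho^k for k in A is a probability law because B(rho) = 1. The whole
    proposition comes from two facts about u: it is bounded by 1, and it
    converges to 1 / mu, where mu = rho B'(rho) is the mean of f.

    The convergence ([renewal]) is proved by the argument of Erdos, Feller and
    Pollard, without complex analysis. Let L be the limsup of u, reached along
    indices phi(j). Since u(phi(j)) is an average of earlier values that are
    asymptotically at most L, each value that carries positive weight must also
    tend to L; so u(phi(j) - a) tends to L for each a in A, then for each a in
    the additive semigroup generated by A, which contains all large integers
    since gcd(A) = 1. Along phi(j) - N all earlier values then tend to L. With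
    r(k) the tail mass of f above k, the sum of r(k) u(n - k) is 1 for every n;
    taking the limit along phi(j) - N gives mu L = 1. The same argument for -u
    identifies the liminf. Since mu is the value of z B'(z) at rho, this is the
    claimed asymptotics of t(n).

    The zero rho of 1 - B is dominant by the equality case of the triangle
    inequality: if B(z) = 1 and |z| <= rho, comparing real parts term by term
    with B(rho) = 1 forces z^a = rho^a for all a in A, and the exponents m with
    z^m = rho^m are closed under sums and differences, so z = rho.

    A composition of n starts with k copies of p exactly when it is that block
    followed by a composition of n - pk ([count_prefix]). Hence
    P(P_n = p, K_n >= k) = t(n - pk) / t(n), which tends to rho^(pk), and the
    limit law (P, K) and its marginals are geometric sums.

    For the moments, S^r is a telescoping sum over the multiples of P up to S,
    which turns E[S_n^r] into the sum over m of A_r(m) t(n - m) / t(n), that is,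
    1 / u(n) times the convolution of A_r(m) rho^m with u. The bound u <= 1
    permits dominated convergence ([convolution_cvg]). *)

(** * Sets of integers of greatest common divisor 1 *)

(** The least positive element of G divides every element of G, by Euclidean
    division, hence divides every element of A. *)
Lemma gcd1_diff_closed (A G : set nat) :
  (forall d : nat, (forall a, A a -> (d %| a)%N) -> d = 1%N) ->
  A `<=` G -> (forall m n, G m -> G n -> G (m + n)%N) ->
  (forall m n, G m -> G (m + n)%N -> G n) -> G 1%N.
Proof.
move=> A_gcd AG GD GB.
have [a0 Aa0 a0_gt0] : exists2 a, A a & (0 < a)%N.
  apply: contrapT => noA; have //: 2%N = 1%N; apply: A_gcd => a Aa.
  by case: a Aa => // a Aa; case: noA; exists a.+1.
have G0 : G 0%N by apply: (GB a0); rewrite ?addn0; apply: AG.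
pose P : pred nat := fun n => (0 < n)%N && `[< G n >].
have exP : exists n, P n by exists a0; rewrite /P a0_gt0; apply/asboolP/AG.
case: (ex_minnP exP) => g /andP[g_gt0 /asboolP Gg] g_min.
suff <- : g = 1%N by [].
apply: A_gcd => a Aa.
have Gmul k : G (k * g)%N by elim: k => [|k IH] //; rewrite mulSn; apply: GD.
have Gr : G (a %% g)%N.
  by apply: (GB (a %/ g * g)%N) => //; rewrite -divn_eq; apply: AG.
rewrite /dvdn; apply/negPn/negP; rewrite -lt0n => r_gt0.
have : P (a %% g)%N by rewrite /P r_gt0; exact/asboolP.
by move/g_min; rewrite leqNgt ltn_mod g_gt0.
Qed.

(** The differences of elements of S satisfy the hypotheses of
    [gcd1_diff_closed], so S contains two consecutive integers s and s + 1;
    every n >= s^2 is a nonnegative combination of these. *)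
Lemma gcd1_semigroup_cofinite (A S : set nat) :
  (forall d : nat, (forall a, A a -> (d %| a)%N) -> d = 1%N) ->
  A `<=` S -> S 0%N -> (forall m n, S m -> S n -> S (m + n)%N) ->
  exists N, forall n, (N <= n)%N -> S n.
Proof.
move=> A_gcd AS S0 SD.
have Smul k x : S x -> S (k * x)%N.
  by move=> Sx; elim: k => [|k IH] //; rewrite mulSn; apply: SD.
have [s Ss Ss1] : exists2 s, S s & S (s + 1)%N.
  apply: (gcd1_diff_closed (G := [set d | exists2 s, S s & S (s + d)%N]) A_gcd).
  - by move=> a Aa; exists 0%N; rewrite //= add0n; apply: AS.
  - move=> m n /= [s Ss Ssm] [t St Stn]; exists (s + t)%N; first exact: SD.
    by rewrite addnACA; apply: SD.
  - move=> m n /= [t St Stm] [s Ss Ssmn]; exists (s + (t + m))%N; first exact: SD.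
    have -> : (s + (t + m) + n = s + (m + n) + t)%N by lia.
    exact: SD.
exists (s * s)%N => n n_ge.
have [s0|s_gt0] := posnP s.
  by move: (Smul n 1%N); rewrite muln1; apply; move: Ss1; rewrite s0.
have r_lt := ltn_pmod n s_gt0.
have q_ge : (s <= n %/ s)%N by rewrite leq_divRL.
(* n = q s + r with r < s <= q, so r of the q copies of s can become s + 1. *)
have -> : n = ((n %/ s - n %% s) * s + (n %% s) * (s + 1))%N.
  have := divn_eq n s; nia.
by apply: SD; apply: Smul.
Qed.

(** * Dominated convergence for sums of growing length *)

(** Dominated convergence, with h itself as the summable majorant: beyond an
    index K where the tail of h is small, the w j k only contribute that tail,
    and the first K terms form a finite sum. *)
Lemma tannery (R : realType) (h : R^nat) (w : nat -> nat -> R)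
    (N : nat -> nat) (l H : R) :
  (forall k, 0 <= h k) -> series h @ \oo --> H ->
  (forall j k, `|w j k| <= 1) -> (forall k, w j k @[j --> \oo] --> l) ->
  N j @[j --> \oo] --> \oo ->
  \sum_(0 <= k < N j) h k * w j k @[j --> \oo] --> H * l.
Proof.
move=> h0 hH w1 wl Noo.
have l1 : `|l| <= 1.
  have wl0 : `|w j 0%N| @[j --> \oo] --> `|l| by apply: cvg_norm; exact: wl.
  by rewrite -(cvg_lim _ wl0)//; apply: limr_le; [apply/cvg_ex; exists `|l| | near=> j; exact: w1].
have hnd : nondecreasing_seq (series h).
  by apply: nondecreasing_series => n _ _; exact: h0.
have hle n : series h n <= H.
  by rewrite -(cvg_lim _ hH)//; apply: nondecreasing_cvgn_le => //; apply/cvg_ex; exists H.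
apply/cvgrPdist_lt => e e0.
have e4 : 0 < e / 4 by lra.
have /cvgrPdist_lt/(_ _ e4)[K _ hK] := hH.
have {hK} := hK K (leqnn K); set SK := series h K => hK.
have hK' : H - SK < e / 4 by apply: le_lt_trans hK; exact: ler_norm.
have wK : \sum_(0 <= k < K) h k * w j k @[j --> \oo] --> SK * l.
  rewrite /SK /series /= big_distrl /=.
  elim: K {hK hK' SK} => [|K IH].
    by under eq_fun do rewrite big_nil; rewrite big_nil; exact: cvg_cst.
  under eq_fun do rewrite big_nat_recr //=.
  by rewrite big_nat_recr //=; apply: cvgD => //; apply: cvgMr.
have /cvgrPdist_lt/(_ _ e4) wK' := wK.
near=> j.
have KN : (K <= N j)%N by near: j; exact: (Noo _ (nbhs_infty_ge K)).
have wKj : `|SK * l - \sum_(0 <= k < K) h k * w j k| < e / 4 by near: j.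
rewrite (big_cat_nat _ KN)//=.
have tail : `|\sum_(K <= k < N j) h k * w j k| <= series h (N j) - SK.
  rewrite /SK sub_series_geq // (le_trans (ler_norm_sum _ _ _))//.
  apply: ler_sum => k _; rewrite normrM ger0_norm// -[leRHS]mulr1.
  by apply: ler_wpM2l.
have HNj := hle (N j); have HK := hle K; rewrite -/SK in HK.
have : `|(H - SK) * l| <= H - SK.
  by rewrite normrM ger0_norm ?subr_ge0// -[leRHS]mulr1 ler_wpM2l ?subr_ge0.
move: tail wKj; set X := \sum_(_ <= _ < K) _; set Y := \sum_(_ <= _ < _) _.
move=> Yb Xb Hb.
have -> : H * l - (X + Y) = (SK * l - X) + ((H - SK) * l - Y) by ring.
rewrite (le_lt_trans (ler_normD _ _))//.
have := ler_normB ((H - SK) * l) Y; lra.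
Unshelve. all: by end_near. Qed.

(** Along a general index sequence phi, since the renewal argument evaluates
    convolutions on a subsequence only. *)
Lemma convolution_cvg (R : realType) (h v : R^nat) (phi : nat -> nat) (l H : R) :
  (forall k, 0 <= h k) -> series h @ \oo --> H ->
  (forall n, `|v n| <= 1) -> phi j @[j --> \oo] --> \oo ->
  (forall k, v (phi j - k)%N @[j --> \oo] --> l) ->
  \sum_(0 <= k < (phi j).+1) h k * v (phi j - k)%N @[j --> \oo] --> H * l.
Proof.
move=> h0 hH v1 phioo vl; apply: tannery => //.
move=> P [N _ NP].
have : \forall j \near \oo, (N <= phi j)%N := phioo _ (nbhs_infty_ge N).
rewrite -[nbhs _ P]/(\forall j \near \oo, P (phi j).+1).
by apply: filterS => j jN; apply: NP; exact: leqW.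
Qed.

(** * The renewal theorem *)

Lemma cvg_subn_infty (phi : nat -> nat) (k : nat) :
  phi j @[j --> \oo] --> \oo -> (phi j - k)%N @[j --> \oo] --> \oo.
Proof.
move=> phioo P [N _ NP].
have : \forall j \near \oo, (N + k <= phi j)%N := phioo _ (nbhs_infty_ge (N + k)).
rewrite -[nbhs _ P]/(\forall j \near \oo, P (phi j - k)%N).
by apply: filterS => j jN; apply: NP; rewrite /= leq_subRL//; lia.
Qed.

Lemma sups_ge (R : realType) (v : R^nat) n : has_ubound (range v) -> v n <= sups v n.
Proof.
move=> [M vM]; apply: ub_le_sup; last by exists n => /=.
by exists M => _ [m _ <-]; apply: vM; exists m.
Qed.

Lemma sups_norm_le1 (R : realType) (v : R^nat) n :
  (forall n, `|v n| <= 1) -> `|sups v n| <= 1.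
Proof.
move=> v1; have v1' m : -1 <= v m <= 1 by rewrite -ler_norml.
have ub : has_ubound (range v) by exists 1 => _ [m _ <-]; case/andP: (v1' m).
rewrite ler_norml (le_trans _ (sups_ge n ub)) /=; last by case/andP: (v1' n).
apply: ge_sup; first by exists (v n); exists n => /=.
by move=> _ [m _ <-]; case/andP: (v1' m).
Qed.

(** The convolution of f with the running suprema s of v tends to L, while it
    exceeds v(n) = (f * v)(n) by at least f(a) (s(n - a) - v(n - a)). Along phi
    the excess tends to L - L = 0, so v(n - a) is squeezed against s(n - a). *)
Lemma renewal_limsup_shift (R : realType) (f v : R^nat) (phi : nat -> nat) (L : R) (a : nat) :
  (forall k, 0 <= f k) -> series f @ \oo --> (1 : R) ->
  (forall n, `|v n| <= 1) ->
  (forall n, (0 < n)%N -> v n = \sum_(0 <= k < n.+1) f k * v (n - k)%N) ->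
  sups v @ \oo --> L -> 0 < f a ->
  phi j @[j --> \oo] --> \oo -> v (phi j) @[j --> \oo] --> L ->
  v (phi j - a)%N @[j --> \oo] --> L.
Proof.
move=> f0 f1 v1 vE sL fa phioo vL.
have ub : has_ubound (range v).
  by exists 1 => _ [m _ <-]; rewrite (le_trans (ler_norm _)).
have sphi k : sups v (phi j - k)%N @[j --> \oo] --> L.
  exact: (cvg_comp _ _ (cvg_subn_infty k phioo) sL).
have conv := convolution_cvg f0 f1 (fun n => sups_norm_le1 n v1) phioo sphi.
rewrite mul1r in conv.
have low : sups v (phi j - a)%N - (f a)^-1 *
    (\sum_(0 <= k < (phi j).+1) f k * sups v (phi j - k)%N - v (phi j))
    @[j --> \oo] --> L.
  have LE : L - (f a)^-1 * (L - L) = L by rewrite subrr mulr0 subr0.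
  rewrite -[X in _ --> X]LE.
  apply: cvgB; first exact: sphi.
  by apply: cvgMr; apply: cvgB.
apply: squeeze_cvgr low (sphi a).
have : \forall j \near \oo, (a.+1 <= phi j)%N := phioo _ (nbhs_infty_ge a.+1).
apply: filterS => j aj; apply/andP; split; last exact: sups_ge.
rewrite lerBlDl addrC -lerBlDl ler_pdivlMl// (vE (phi j)); last by lia.
rewrite -sumrB.
under eq_bigr do rewrite -mulrBr.
rewrite (bigD1_seq a) ?iota_uniq//=; last by rewrite mem_index_iota; lia.
by rewrite lerDl; apply: sumr_ge0 => k _; rewrite mulr_ge0 ?subr_ge0 ?sups_ge.
Qed.

(** Stated for sequences v of any sign: it is applied to u and to -u, and the
    two limsups then pin down the limit of u. *)
Lemma renewal_limsup_value (R : realType) (f v : R^nat) (r : R^nat) (c mu : R) :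
  (forall k, 0 <= f k) -> series f @ \oo --> (1 : R) ->
  (forall d : nat, (forall a, 0 < f a -> (d %| a)%N) -> d = 1%N) ->
  (forall n, `|v n| <= 1) ->
  (forall n, (0 < n)%N -> v n = \sum_(0 <= k < n.+1) f k * v (n - k)%N) ->
  (forall k, 0 <= r k) -> series r @ \oo --> mu ->
  (forall n, \sum_(0 <= k < n.+1) r k * v (n - k)%N = c) ->
  exists2 L, sups v @ \oo --> L & mu * L = c.
Proof.
move=> f0 f1 f_gcd v1 vE r0 rmu rc.
have ub : has_ubound (range v).
  by exists 1 => _ [m _ <-]; rewrite (le_trans (ler_norm _)).
have lb : has_lbound (range v).
  by exists (-1) => _ [m _ <-]; have := v1 m; rewrite ler_norml => /andP[].
have := cvg_sups_inf ub lb; set L := inf _ => sL; exists L => //.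
have near_sup (j : nat) : exists m, (j <= m)%N /\ sups v j - j.+1%:R^-1 < v m.
  have j1 : 0 < j.+1%:R^-1 :> R by rewrite invr_gt0.
  have hs : has_sup (sdrop v j).
    split; first by exists (v j); exists j => /=.
    by case: ub => M vM; exists M => _ [m _ <-]; apply: vM; exists m.
  by have [_ [m jm <-] vm] := sup_adherent j1 hs; exists m.
(* phi realizes the limsup: v(phi j) lies within 1/(j+1) of sup_{m >= j} v m. *)
have [phi phiP] := boolp.choice near_sup.
have phioo : phi j @[j --> \oo] --> \oo.
  move=> P [N _ NP]; exists N => // j /= Nj; apply: NP => /=.
  by apply: leq_trans Nj _; case: (phiP j).
have vphi : v (phi j) @[j --> \oo] --> L.
  have low : sups v j - j.+1%:R^-1 @[j --> \oo] --> L.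
    by rewrite -[X in _ --> X]subr0; apply: cvgB => //; exact: cvg_harmonic.
  apply: squeeze_cvgr low sL; apply: nearW => j.
  case: (phiP j) => jphi /ltW ->; apply: ub_le_sup; last by exists (phi j).
  by case: ub => M vM; exists M => _ [m _ <-]; apply: vM; exists m.
pose S := [set m | v (phi j - m)%N @[j --> \oo] --> L].
have Sadd a m : 0 < f a -> S m -> S (m + a)%N.
  move=> fa Sm; rewrite /S /=.
  under eq_fun do rewrite subnDA.
  by apply: (renewal_limsup_shift f0 f1 v1 vE sL fa (cvg_subn_infty m phioo)).
(* S itself is only known to absorb the steps a; T, its set of admissible
   shifts, is a semigroup. *)
pose T := [set m | forall k, S k -> S (k + m)%N].
have [N NS] : exists N, forall n, (N <= n)%N -> T n.
  apply: (gcd1_semigroup_cofinite (A := [set a | 0 < f a])) => //.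
  - by move=> a fa k Sk; apply: Sadd.
  - by move=> k; rewrite addn0.
  - by move=> m n Tm Tn k Sk; rewrite addnA; apply/Tn/Tm.
have S0 : S 0%N by rewrite /S /=; under eq_fun do rewrite subn0.
have shifted k : v (phi j - N - k)%N @[j --> \oo] --> L.
  under eq_fun do rewrite -subnDA.
  by apply: (NS (N + k)%N _ 0%N S0); rewrite leq_addr.
have := convolution_cvg r0 rmu v1 (cvg_subn_infty N phioo) shifted.
under eq_fun do rewrite rc.
by move=> /(cvg_lim _) <-//; rewrite lim_cst.
Qed.

(** r is the sequence of tail masses of f; as its sum mu is the mean of f, the
    limit is the usual reciprocal of the mean. *)
Theorem renewal (R : realType) (f u : R^nat) (r : R^nat) (mu : R) :
  (forall k, 0 <= f k) -> f 0%N = 0 -> series f @ \oo --> (1 : R) ->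
  (forall d : nat, (forall a, 0 < f a -> (d %| a)%N) -> d = 1%N) ->
  (forall n, 0 <= u n) -> u 0%N = 1 ->
  (forall n, (0 < n)%N -> u n = \sum_(0 <= k < n.+1) f k * u (n - k)%N) ->
  (forall n, r n = 1 - \sum_(0 <= k < n.+1) f k) ->
  series r @ \oo --> mu ->
  [/\ forall n, u n <= 1, 0 < mu & u @ \oo --> mu^-1].
Proof.
move=> f0 f00 f1 f_gcd u0 u00 uE rE rmu.
have r_ge0 n : 0 <= r n.
  rewrite rE subr_ge0 -(cvg_lim _ f1)//.
  apply: (nondecreasing_cvgn_le (u_ := series f)); last by apply/cvg_ex; exists 1.
  by apply: nondecreasing_series => k _ _; exact: f0.
have r0 : r 0%N = 1 by rewrite rE big_nat1 f00 subr0.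
(* By r(k+1) = r(k) - f(k+1), the step from n to n + 1 adds u(n+1) and removes
   the convolution (f * u)(n+1), which is the same number. *)
have ruE n : \sum_(0 <= k < n.+1) r k * u (n - k)%N = 1.
  elim: n => [|n IH]; first by rewrite big_nat1 r0 u00 mul1r.
  rewrite big_nat_recl// r0 mul1r subn0.
  have rS k : r k.+1 = r k - f k.+1 by rewrite !rE [in LHS]big_nat_recr //=; ring.
  under eq_bigr do rewrite rS subSS mulrBl.
  rewrite sumrB IH (uE n.+1)// big_nat_recl// f00 mul0r.
  under [in X in X + _]eq_bigr do rewrite subSS.
  ring.
have u_le1 n : u n <= 1.
  rewrite -(ruE n) big_nat_recl// r0 mul1r subn0 lerDl.
  by apply: sumr_ge0 => k _; rewrite mulr_ge0.
have u_norm n : `|u n| <= 1 by rewrite ger0_norm.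
have nu_norm n : `|(- u) n| <= 1 by rewrite normrN.
have [L uL muL] := renewal_limsup_value f0 f1 f_gcd u_norm uE r_ge0 rmu ruE.
have [L' uL' muL'] : exists2 L, sups (- u) @ \oo --> L & mu * L = -1.
  apply: (renewal_limsup_value f0 f1 f_gcd nu_norm _ r_ge0 rmu) => n => [n0|].
    rewrite [LHS]/GRing.opp /= (uE n n0) -sumrN; apply: eq_bigr => k _.
    by rewrite /GRing.opp /= mulrN.
  rewrite -(ruE n) -sumrN; apply: eq_bigr => k _.
  by rewrite {1}/GRing.opp /= mulrN.
have mu_ge0 : 0 <= mu.
  rewrite -(cvg_lim _ rmu)//; apply: limr_ge; first by apply/cvg_ex; exists mu.
  by apply: nearW => n; apply: sumr_ge0.
have mu_neq0 : mu != 0.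
  by apply/eqP => mu0; move: muL; rewrite mu0 mul0r => /esym/eqP; rewrite oner_eq0.
have LE : L = mu^-1 by apply: (mulfI mu_neq0); rewrite muL divff.
have LE' : L' = - mu^-1 by apply: (mulfI mu_neq0); rewrite muL' mulrN divff.
split=> //; first by rewrite lt_def mu_neq0.
have ub : has_ubound (range u) by exists 1 => _ [m _ <-].
have ub' : has_ubound (range (- u)).
  by exists 1 => _ [m _ <-]; rewrite (le_trans (ler_norm _)).
have low : - sups (- u) n @[n --> \oo] --> mu^-1.
  by rewrite -[X in _ --> X]opprK -LE'; apply: cvgN.
rewrite LE in uL; apply: squeeze_cvgr low uL; apply: nearW => n.
by rewrite sups_ge// andbT lerNl; exact: (sups_ge n ub').
Qed.

(** * The series of the parts and its derivative *)

(** The formula E X = sum of P(X > k). The partial sums differ from those of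
    n f(n) by n P(X >= n), which is at most the remainder of the mean. *)
Lemma tail_sum_cvg (R : realType) (f : R^nat) (mu : R) :
  (forall k, 0 <= f k) -> series f @ \oo --> (1 : R) ->
  series (fun n => n%:R * f n) @ \oo --> mu ->
  series (fun n => 1 - \sum_(0 <= k < n.+1) f k) @ \oo --> mu.
Proof.
move=> f0 f1 fmu; set D := series (fun n => n%:R * f n) in fmu *.
have fD0 n : 0 <= n%:R * f n by rewrite mulr_ge0.
have f_nd : nondecreasing_seq (series f) by apply: nondecreasing_series.
have D_nd : nondecreasing_seq D by apply: nondecreasing_series.
have le1 n : series f n <= 1.
  by rewrite -(cvg_lim _ f1)//; apply: nondecreasing_cvgn_le => //; apply/cvg_ex; exists 1.
have rE n : series (fun n => 1 - \sum_(0 <= k < n.+1) f k) n =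
    D n + n%:R * (1 - series f n).
  rewrite /D /series /=.
  elim: n => [|n IH]; first by rewrite !big_nil mul0r addr0.
  rewrite !big_nat_recr //= IH -natr1; ring.
have rem_le n : n%:R * (1 - series f n) <= mu - D n.
  have lhs : n%:R * (series f m - series f n) @[m --> \oo] --> n%:R * (1 - series f n).
    by apply: cvgMr; apply: cvgB => //; exact: cvg_cst.
  have rhs : D m - D n @[m --> \oo] --> mu - D n.
    by apply: cvgB => //; exact: cvg_cst.
  apply: (ler_cvg_to lhs rhs); exists n => // m /= nm.
  rewrite /D !sub_series_geq// mulr_sumr; apply: ler_sum_nat => k /andP[nk _].
  by rewrite ler_wpM2r// ler_nat.
have rem0 : n%:R * (1 - series f n) @[n --> \oo] --> (0 : R).
  have up : mu - D n @[n --> \oo] --> (0 : R).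
    by rewrite -(subrr mu); apply: cvgB => //; exact: cvg_cst.
  apply: squeeze_cvgr (cvg_cst (0 : R)) up; apply: nearW => n.
  by rewrite rem_le andbT mulr_ge0// subr_ge0.
rewrite (_ : series _ = fun n => D n + n%:R * (1 - series f n)); last exact/funext.
by rewrite -[X in _ --> X]addr0; apply: cvgD.
Qed.

(** The partial sums are bounded by (1 - q)^-2, by the closed form of the sum
    of (k + 1) q^k over k < n. *)
Lemma cvg_series_natS_expr (R : realType) (q : R) :
  0 <= q < 1 -> cvgn (series (fun n => n.+1%:R * q ^+ n : R)).
Proof.
move=> /andP[q0 q1]; apply: nondecreasing_is_cvgn.
  by apply: nondecreasing_series => n _ _; rewrite mulr_ge0// exprn_ge0.
have q1' : 0 < (1 - q) ^+ 2 by rewrite exprn_gt0// subr_gt0.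
exists ((1 - q) ^- 2) => _ [n _ <-].
rewrite -[leRHS]mul1r ler_pdivlMr//.
suff -> : series (fun n => n.+1%:R * q ^+ n) n * (1 - q) ^+ 2 =
    1 - q ^+ n - n%:R * (1 - q) * q ^+ n.
  have qn : 0 <= q ^+ n by rewrite exprn_ge0.
  have : 0 <= n%:R * (1 - q) * q ^+ n by rewrite !mulr_ge0// subr_ge0 ltW.
  lra.
rewrite /series /=; elim: n => [|n IH]; first by rewrite big_nil expr0; ring.
by rewrite big_nat_recr //= mulrDl IH -natr1 (exprS q); ring.
Qed.

(** The coefficients are dominated by M y^-n for some y with |x| < y < 1, and
    (n + 1) (|x| / y)^n is summable. *)
Lemma cvg_pseries_diffs (R : realType) (c : R^nat) :
  (forall x : R, `|x| < 1 -> cvgn (pseries c x)) ->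
  forall x : R, `|x| < 1 -> cvgn (pseries (pseries_diffs c) x).
Proof.
move=> cvg_c x x1; pose y := (`|x| + 1) / 2.
have x0 : 0 <= `|x| by [].
have y0 : 0 < y by rewrite /y; lra.
have y1 : y < 1 by rewrite /y; lra.
have xy : `|x| < y by rewrite /y; lra.
have [M [_ cM]] : bounded_fun (fun n => c n * y ^+ n).
  by apply: cvg_series_bounded; apply: cvg_c; rewrite gtr0_norm.
have {}cM n : `|c n * y ^+ n| <= `|M| + 1.
  by apply: cM => //; rewrite (le_lt_trans (ler_norm _))// ltrDl.
apply: normed_cvg; rewrite /normed_series_of /=.
have q01 : 0 <= `|x| / y < 1 by apply/andP; split; [rewrite divr_ge0// ltW | rewrite ltr_pdivrMr// mul1r].
have := cvg_series_natS_expr q01.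
move=> /(is_cvg_seriesZ (k := (`|M| + 1) / y)); apply: series_le_cvg => n //=.
  by apply: mulr_ge0; [rewrite divr_ge0 ?addr_ge0// ltW | rewrite mulr_ge0// exprn_ge0// divr_ge0// ltW].
rewrite /pseries_diffs /GRing.scale /= !normrM normrX normr_nat.
rewrite expr_div_n [leRHS]mulrCA -[leLHS]mulrA ler_wpM2l//.
have -> : (`|M| + 1) / y * (`|x| ^+ n / y ^+ n) = (`|M| + 1) / y ^+ n.+1 * `|x| ^+ n.
  by rewrite exprS; field; rewrite expf_neq0 ?gt_eqF.
rewrite ler_wpM2r ?exprn_ge0// ler_pdivlMr ?exprn_gt0//.
by have := cM n.+1; rewrite normrM normrX (gtr0_norm y0).
Qed.

Section PartSeries.
Variables (R : realType) (A : set nat).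

Let c (n : nat) : R := (n \in A)%:R.

Lemma Bseries_cvg (x : R) : `|x| < 1 -> cvgn (Bseries A x).
Proof.
move=> x1; apply: normed_cvg.
have := @is_cvg_geometric_series R 1 `|x|; rewrite normr_id => /(_ x1).
apply: series_le_cvg => n //=.
by rewrite mul1r normrM normrX normr_nat ler_piMl ?exprn_ge0// lern1 leq_b1.
Qed.

(** At x = rho the left side is the mean of the renewal law. Termwise
    differentiation needs the second derived series to converge beyond x, which
    holds up to radius 1 because the coefficients of B are 0 or 1. *)
Lemma B_derive1 (x : R) : `|x| < 1 ->
  series (fun n => n%:R * ((n \in A)%:R * x ^+ n) : R) @ \oo
    --> x * derive1 (B A : R -> R) x.
Proof.
move=> x1; pose y := (`|x| + 1) / 2.
have x0 : 0 <= `|x| by [].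
have y0 : 0 < y by rewrite /y; lra.
have y1 : `|y| < 1 by rewrite gtr0_norm // /y; lra.
have xy : `|x| < `|y| by rewrite (gtr0_norm y0) /y; lra.
have c1 := cvg_pseries_diffs Bseries_cvg.
have c2 := cvg_pseries_diffs c1.
have dB : is_derive x 1 (fun x => limn (pseries c x)) (limn (pseries (pseries_diffs c) x)).
  by apply: (@pseries_snd_diffs _ _ y) => //; [exact: Bseries_cvg|exact: c1|exact: c2].
have -> : derive1 (B A : R -> R) x = limn (pseries (pseries_diffs c) x).
  by rewrite derive1E; exact: derive_val.
have -> : series (fun n => n%:R * ((n \in A)%:R * x ^+ n) : R) =
    (fun n => x * series (fun i => i%:R * c i * x ^+ i.-1) n).
  apply/funext => n; rewrite /series /= mulr_sumr; apply: eq_bigr => k _.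
  case: k => [|k]; first by rewrite !mul0r mulr0.
  by rewrite /c exprS /=; ring.
by apply: cvgMr; exact: pseries_diffs_equiv (c1 _ x1).
Qed.

End PartSeries.

(** * Asymptotics of the number of compositions *)

Lemma weighted_ncomp_renewal (R : realType) (A : set nat) (x : R) n :
  ~ A 0%N -> (0 < n)%N ->
  (ncomp A n)%:R * x ^+ n =
    \sum_(0 <= k < n.+1) (k \in A)%:R * x ^+ k * ((ncomp A (n - k))%:R * x ^+ (n - k)).
Proof.
move=> A0 n0; rewrite ncomp_genfun// gtn_eqF// add0n natr_sum mulr_suml.
rewrite big_mkord big_mkcond /=; apply: eq_bigr => k _.
case: ifP => kA; last by rewrite !mul0r.
by rewrite mul1r mulrCA -exprD subnKC// -ltnS.
Qed.

Lemma ncomp0 (A : set nat) : ncomp A 0 = 1%N.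
Proof. by rewrite /ncomp compositions0 fset_set1 cardfs1. Qed.

Lemma ncomp_asymptotics (R : realType) (A : set nat) (rho : R) :
  ~ A 0%N -> 0 < rho < 1 -> B A rho = 1 ->
  (forall d : nat, (forall a, A a -> (d %| a)%N) -> d = 1%N) ->
  let mu := rho * derive1 (B A : R -> R) rho in
  [/\ forall n, (ncomp A n)%:R * rho ^+ n <= 1, 0 < mu &
      (ncomp A n)%:R * rho ^+ n @[n --> \oo] --> mu^-1].
Proof.
move=> A0 /andP[rho0 rho1] B1 A_gcd mu.
have rho_norm : `|rho| < 1 by rewrite gtr0_norm.
pose f k : R := (k \in A)%:R * rho ^+ k.
have f0 k : 0 <= f k by rewrite mulr_ge0// exprn_ge0// ltW.
have f1 : series f @ \oo --> (1 : R) by rewrite -B1; exact: Bseries_cvg.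
apply: (renewal f0 _ f1 (r := fun n => 1 - \sum_(0 <= k < n.+1) f k)).
- by rewrite /f memNset// mul0r.
- move=> d df; apply: A_gcd => a Aa; apply: df.
  by rewrite /f mem_set// mul1r exprn_gt0.
- by move=> n; rewrite mulr_ge0// exprn_ge0// ltW.
- by rewrite ncomp0 expr0 mulr1.
- by move=> n n0; exact: weighted_ncomp_renewal.
- by [].
- by apply: tail_sum_cvg => //; exact: B_derive1.
Qed.

Lemma equiv_of_weighted_cvg (R : realType) (t : R^nat) (rho mu : R) :
  0 < rho -> 0 < mu -> t n * rho ^+ n @[n --> \oo] --> mu^-1 ->
  t ~_\oo (fun n => rho ^- n / mu).
Proof.
move=> rho0 mu0 tmu; apply/eqaddoP => e e0.
have emu : 0 < e / mu by rewrite divr_gt0.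
move/cvgrPdist_lt : tmu => /(_ _ emu); apply: filterS => n.
rewrite distrC => /ltW tn.
have rn : 0 < rho ^+ n by rewrite exprn_gt0.
rewrite -(ler_pM2r rn).
have -> : `|(t - (fun n => rho ^- n / mu)) n| * rho ^+ n = `|t n * rho ^+ n - mu^-1|.
  rewrite -{1}(gtr0_norm rn) -normrM; congr `|_|.
  by rewrite !fctE /=; field; rewrite !gt_eqF.
apply: (le_trans tn); rewrite ger0_norm; last by rewrite divr_ge0 ?invr_ge0// ltW.
by rewrite le_eqVlt; apply/orP; left; apply/eqP; field; rewrite !gt_eqF.
Qed.

(** * Compositions with a prescribed initial run *)

Lemma prefix_nseqE (T : eqType) (p : T) k s :
  prefix (nseq k p) s = (k <= find (fun a => a != p) s)%N.
Proof.
elim: k s => [|k IH] [|a s] //=.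
by rewrite IH eq_sym; case: eqP.
Qed.

(** Prefix conditions on [nseq k p] are the events P = p, K >= k; they are what
    can be counted by removing the block. *)
Lemma prefix_runE p k s : (0 < k)%N ->
  prefix (nseq k p) s = (first_part s == p) && (k <= run_length s)%N.
Proof.
case: s => [|a s]; first by case: k => // k _; rewrite /= andbF.
case: k => // k _; rewrite /run_length /= eqxx /=.
by case: eqVneq => [->|] //=; rewrite prefix_nseqE.
Qed.

Lemma compositions_nseq_cat (A : set nat) p k s n :
  A p -> (0 < p)%N ->
  compositions A n (nseq k p ++ s) <->
    (k * p <= n)%N /\ compositions A (n - k * p) s.
Proof.
move=> Ap p0; elim: k n => [|k IH] n /=; first by rewrite mul0n subn0; split=> [|[]].
rewrite compositions_cons mulSn subnDA; split.
  by move=> [/andP[_ pn] _ /IH[kp cs]]; split=> //; lia.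
move=> [kp cs]; split=> //; first by lia.
by apply/IH; split=> //; lia.
Qed.

Lemma mem_compositions (A : set nat) n s :
  (s \in fset_set (compositions A n)) = (s \in compositions A n).
Proof. by rewrite in_fset_set//; exact: finite_compositions. Qed.

Lemma count_prefix (A : set nat) p k n : A p -> (0 < p)%N ->
  count (prefix (nseq k p)) (fset_set (compositions A n)) =
  if (k * p <= n)%N then ncomp A (n - k * p) else 0%N.
Proof.
move=> Ap p0; rewrite -size_filter; case: ifPn => kn.
  rewrite /ncomp -[RHS](size_map (cat (nseq k p))); apply: perm_size; apply: uniq_perm.
  - by rewrite filter_uniq// fset_uniq.
  - rewrite map_inj_uniq ?fset_uniq// => x y /eqP.
    by rewrite eqseq_cat// eqxx => /eqP.
  move=> s; rewrite mem_filter mem_compositions; apply/andP/mapP.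
    move=> [/prefixP[t ->]] /set_mem /compositions_nseq_cat -/(_ Ap p0) [_ ct].
    by exists t => //; rewrite mem_compositions mem_set.
  move=> [t]; rewrite mem_compositions => /set_mem ct ->; rewrite prefix_prefix.
  by split=> //; apply/mem_set/compositions_nseq_cat.
apply/eqP; rewrite size_eq0; apply/eqP; apply/eqP; rewrite -[_ == _]negbK -has_filter.
apply/hasPn => s; rewrite mem_compositions => /set_mem cs.
apply/negP => /prefixP[t ts]; move: cs; rewrite ts.
by move=> /compositions_nseq_cat -/(_ Ap p0) [kn' _]; rewrite kn' in kn.
Qed.

Lemma card_compositionsI (A : set nat) n (P : pred (seq nat)) :
  #|` fset_set (compositions A n `&` [set s | P s])|%fset =
  count P (fset_set (compositions A n)).
Proof.
rewrite -size_filter; apply: perm_size; apply: uniq_perm; rewrite ?filter_uniq ?fset_uniq//.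
move=> s; rewrite mem_filter mem_compositions in_fset_set; last first.
  by apply: finite_setIl; exact: finite_compositions.
by rewrite in_setI andbC; congr (_ && _); apply/idP/idP => [/set_mem|/mem_set].
Qed.

(** The event K = k is the difference of K >= k and K >= k + 1; it is stated
    additively because subtraction on naturals is truncated. *)
Lemma count_initial_run (A : set nat) p k n : A p -> (0 < p)%N -> (0 < k)%N ->
  (k.+1 * p <= n)%N ->
  (#|` fset_set (compositions A n `&`
      [set s | first_part s = p /\ run_length s = k])|%fset + ncomp A (n - k.+1 * p))%N
  = ncomp A (n - k * p).
Proof.
move=> Ap p0 k0 kn.
have -> : [set s | first_part s = p /\ run_length s = k] =
    [set s | (first_part s == p) && (run_length s == k)].
  by apply/seteqP; split=> s /= => [[-> ->]|/andP[/eqP -> /eqP ->]]; rewrite ?eqxx.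
have cnt m : (0 < m)%N -> (m * p <= n)%N ->
    count (fun s => (first_part s == p) && (m <= run_length s)%N)
      (fset_set (compositions A n)) = ncomp A (n - m * p).
  move=> m0 mn; have := count_prefix m n Ap p0; rewrite mn => <-.
  by apply: eq_count => s; rewrite prefix_runE.
rewrite -(cnt k)//; last by lia.
rewrite -(cnt k.+1)// card_compositionsI -count_predUI [X in (_ + X)%N](_ : _ = 0%N).
  rewrite addn0; apply: eq_count => s /=; case: (_ == p) => //=.
  by rewrite [RHS]leq_eqVlt eq_sym.
rewrite -(count_pred0 (fset_set (compositions A n))); apply: eq_count => s /=.
by case: (_ == p) => //=; case: ltngtP.
Qed.

Lemma comp_prob_initial_run_cvg (R : realType) (A : set nat) (rho mu : R) p k :
  ~ A 0%N -> 0 < rho -> 0 < mu ->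
  (ncomp A n)%:R * rho ^+ n @[n --> \oo] --> mu^-1 ->
  A p -> (0 < k)%N ->
  comp_prob R A n [set s | first_part s = p /\ run_length s = k]
    @[n --> \oo] --> rho ^+ (p * k) * (1 - rho ^+ p).
Proof.
move=> A0 rho0 mu0 umu Ap k0.
have p0 : (0 < p)%N by case: p Ap.
pose u n : R := (ncomp A n)%:R * rho ^+ n.
have ratio m : rho ^+ m * u (n - m)%N / u n @[n --> \oo] --> rho ^+ m.
  have mu1 : mu^-1 != 0 by rewrite invr_eq0 gt_eqF.
  have limE : rho ^+ m * mu^-1 / mu^-1 = rho ^+ m by rewrite mulfK.
  rewrite -[X in _ --> X]limE.
  apply: cvgM; last by apply: cvgV.
  by apply: cvgMr; exact: (cvg_comp _ _ (cvg_subn_infty m cvg_id) umu).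
have -> : rho ^+ (p * k) * (1 - rho ^+ p) = rho ^+ (k * p) - rho ^+ (k.+1 * p).
  by rewrite mulSn addnC exprD mulnC; ring.
apply: cvg_trans (cvgB (ratio (k * p)%N) (ratio (k.+1 * p)%N)).
apply: near_eq_cvg; near=> n.
have kn : (k.+1 * p <= n)%N by near: n; exact: nbhs_infty_ge.
have kn' : (k * p <= n)%N by lia.
have w m : (m <= n)%N -> rho ^+ m * u (n - m)%N / u n = (ncomp A (n - m))%:R / (ncomp A n)%:R.
  move=> mn; rewrite /u mulrCA -exprD subnKC// -mulf_div divff ?mulr1//.
  by rewrite expf_neq0// gt_eqF.
rewrite /GRing.add /= /GRing.opp /= !w// /comp_prob -(count_initial_run Ap p0 k0 kn) natrD.
by ring.
Unshelve. all: by end_near. Qed.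

(** * The limit law *)

Lemma esum_of_series (R : realType) (h : R^nat) (H : R) :
  (forall k, 0 <= h k) -> series h @ \oo --> H ->
  (\esum_(k in [set: nat]) (h k)%:E = H%:E)%E.
Proof.
move=> h0 hH; rewrite -nneseries_esumT; last by move=> k; rewrite lee_fin.
have : (\sum_(0 <= k < n) (h k)%:E)%E @[n --> \oo] --> H%:E.
  under eq_fun do rewrite sumEFin.
  by apply: cvg_EFin => //; exact: nearW.
by move/cvg_lim => ->.
Qed.

Section LimitLaw.
Variables (R : realType) (A : set nat) (rho : R).
Hypotheses (A0 : ~ A 0%N) (rho01 : 0 < rho < 1).
Hypothesis pmfE : forall p k, A p -> (0 < k)%N ->
  limit_pmf R A p k = rho ^+ (p * k) * (1 - rho ^+ p).

Let pow_ge0 n : 0 <= rho ^+ n.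
Proof. by case/andP: rho01 => r0 _; rewrite exprn_ge0// ltW. Qed.

Let pow_le1 n : rho ^+ n <= 1.
Proof. by case/andP: rho01 => r0 r1; rewrite exprn_ile1// ltW. Qed.

Let mass_ge0 p k : (0 <= (rho ^+ (p * k) * (1 - rho ^+ p))%:E)%E.
Proof. by rewrite lee_fin mulr_ge0// subr_ge0. Qed.

(** P(P = p, K >= m) in the limit law. *)
Lemma esum_geometric_tail p m : (0 < p)%N ->
  (\esum_(k in [set k | (m <= k)%N]) (rho ^+ (p * k) * (1 - rho ^+ p))%:E
  = (rho ^+ (p * m))%:E)%E.
Proof.
case/andP: rho01 => r0 r1 p0.
have -> : [set k | (m <= k)%N] = addn m @` setT.
  apply/seteqP; split=> [k /= mk|_ [i _ <-]]; last exact: leq_addr.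
  by exists (k - m)%N => //; rewrite subnKC.
rewrite esum_image; last by move=> i j _ _; exact: addnI.
apply: esum_of_series => [k|]; first by rewrite -lee_fin.
have rp1 : `|rho ^+ p| < 1 by rewrite ger0_norm// exprn_ilt1// -?lt0n// ltW.
have := cvg_geometric_series (a := rho ^+ (p * m) * (1 - rho ^+ p)) rp1.
rewrite mulfK; last by rewrite subr_eq0 gt_eqF// (le_lt_trans (ler_norm _)).
have -> : geometric (rho ^+ (p * m) * (1 - rho ^+ p)) (rho ^+ p) =
    (fun i => rho ^+ (p * (m + i)) * (1 - rho ^+ p)); last exact.
by apply/funext => k /=; rewrite mulnDr exprD (exprM rho p k); ring.
Qed.

(** Summing p first and then k over the section of E at p: all the events of
    interest have sections that are half-lines or single points. *)
Lemma limit_prob_sections (E : set (nat * nat)) (I : set nat) (J : nat -> set nat) :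
  I `<=` A -> (forall p k, I p -> J p k -> (0 < k)%N) ->
  E `&` [set x | A x.1 /\ (0 < x.2)%N] = I `*`` J ->
  (limit_prob R A E =
  \esum_(p in I) \esum_(k in J p) (rho ^+ (p * k) * (1 - rho ^+ p))%:E)%E.
Proof.
move=> IA J0 EIJ; rewrite esum_esum// /limit_prob EIJ.
by apply: eq_esum => -[p k] /= [Ip Jk]; rewrite pmfE//; [exact: IA|exact: J0 Jk].
Qed.

Lemma limit_prob_run_ge m : (0 < m)%N ->
  limit_prob R A [set x | (m <= x.2)%N] = (B A (rho ^+ m))%:E.
Proof.
case/andP: (rho01) => r0 r1 m0.
rewrite (limit_prob_sections (I := A) (J := fun _ => [set k | (m <= k)%N]))//; first last.
- apply/seteqP; split=> -[p k] /=; first by move=> [mk [Ap k0]].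
  by move=> [Ap mk]; split=> //; split=> //; exact: leq_trans mk.
- by move=> p k _ /=; exact: leq_trans.
under eq_esum => p Ap.
  by rewrite esum_geometric_tail; [over|case: p Ap].
rewrite esum_mkcond.
transitivity (\esum_(p in [set: nat]) ((p \in A)%:R * (rho ^+ m) ^+ p)%:E)%E.
  apply: eq_esum => p _; rewrite -exprM mulnC.
  by case: ifP; rewrite ?mul1r ?mul0r.
apply: esum_of_series => [k|]; first by rewrite mulr_ge0// exprn_ge0.
by apply: Bseries_cvg; rewrite ger0_norm// exprn_ilt1// -?lt0n// ltW.
Qed.

Lemma limit_prob_setT : limit_prob R A setT = (B A rho)%:E.
Proof.
rewrite -[in RHS](expr1 rho) -limit_prob_run_ge// /limit_prob; congr (esum _ _).
by apply/seteqP; split=> -[p k] /= [_ [Ap k0]].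
Qed.

Lemma limit_prob_part p : A p ->
  limit_prob R A [set x | x.1 = p] = (rho ^+ p)%:E.
Proof.
move=> Ap.
rewrite (limit_prob_sections (I := [set p]) (J := fun _ => [set k | (0 < k)%N]))//.
- rewrite esum_set1; last exact: esum_ge0.
  by rewrite esum_geometric_tail ?muln1//; case: p Ap.
- by move=> q ->.
- apply/seteqP; split=> -[q k] /=; first by move=> [-> [_ k0]].
  by move=> [-> k0].
Qed.

Lemma limit_prob_total s : (0 < s)%N ->
  limit_prob R A [set x | (x.1 * x.2)%N = s] =
  (rho ^+ s * \sum_(d <- divisors s | d \in A) (1 - rho ^+ d))%:E.
Proof.
move=> s0.
rewrite (limit_prob_sections (I := [set` [seq d <- divisors s | d \in A]])
  (J := fun d => [set (s %/ d)%N])).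
- set r := [seq d <- divisors s | d \in A].
  have r_uniq : uniq r by rewrite filter_uniq// divisors_uniq.
  transitivity (\esum_(d in [set` r]) (rho ^+ s * (1 - rho ^+ d))%:E)%E.
    apply: eq_esum => d /=; rewrite mem_filter -dvdn_divisors// => /andP[_ ds].
    rewrite (@esum_set1 _ _ _ (fun k => (rho ^+ (d * k) * (1 - rho ^+ d))%:E)).
      by rewrite [(d * _)%N]mulnC divnK.
    exact: mass_ge0.
  have term_ge0 d : (0 <= (rho ^+ s * (1 - rho ^+ d))%:E)%E.
    by rewrite lee_fin mulr_ge0// subr_ge0.
  rewrite (esum_fset (finite_seq r) (fun d _ => term_ge0 d)).
  rewrite -(fsbig_seq _ _ r_uniq) sumEFin.
  by rewrite /r big_filter mulr_sumr.
- by move=> d /=; rewrite mem_filter => /andP[/set_mem].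
- move=> d k /=; rewrite mem_filter -dvdn_divisors// => /andP[_ ds] ->.
  by rewrite divn_gt0 ?(dvdn_gt0 s0 ds)// dvdn_leq.
- apply/seteqP; split=> -[d k] /=.
    move=> [dk [Ad k0]]; rewrite mem_filter mem_set//= -dvdn_divisors//.
    have d0 : (0 < d)%N by case: (d) Ad.
    by rewrite -dk dvdn_mulr// mulKn.
  rewrite mem_filter -dvdn_divisors// => -[/andP[/set_mem Ad ds] ->].
  split; first by rewrite mulnC divnK.
  by split=> //; rewrite divn_gt0 ?(dvdn_gt0 s0 ds)// dvdn_leq.
Qed.

End LimitLaw.

(** * Moments of the size of the initial run *)

(** With p = P and K the run length, min(m / p, K) p is the largest multiple of
    p that is at most both m and S; it grows from 0 to S as m does, and jumps
    (by p) exactly when m is a multiple of p that is at most S. *)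
Lemma capped_pow_step (R : realType) (p K m r : nat) :
  (0 < p)%N ->
  ((minn (m.+1 %/ p) K * p)%:R ^+ r - (minn (m %/ p) K * p)%:R ^+ r : R) =
  if (p %| m.+1)%N && (m.+1 %/ p <= K)%N
  then m.+1%:R ^+ r - (m.+1%:R - p%:R) ^+ r else 0.
Proof.
move=> p0; have := divnS m p0; case: (boolP (p %| m.+1)%N) => /= [pm|pm] ->.
  rewrite add1n; case: (boolP ((m %/ p).+1 <= K)%N) => qK; last first.
    by rewrite !(minn_idPr _) ?subrr//; lia.
  rewrite (minn_idPl qK) (minn_idPl (ltnW qK)) -natrB; last exact: dvdn_leq.
  have mE : ((m %/ p).+1 * p = m.+1)%N by rewrite -[RHS](divnK pm) divnS// pm.
  by rewrite mE; congr (_ - _%:R ^+ _); rewrite -mE mulSn addKn.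
by rewrite add0n subrr.
Qed.

(** Only the divisor d = P can contribute: a nonempty block of copies of d at
    the front of s forces the first part to be d. *)
Lemma sum_divisors_prefix (R : realType) (A : set nat) (s : seq nat) (m : nat)
    (F : nat -> R) :
  (0 < m)%N -> A (first_part s) ->
  \sum_(d <- divisors m | d \in A) F d * (prefix (nseq (m %/ d) d) s)%:R =
  if (first_part s %| m)%N && (m %/ first_part s <= run_length s)%N
  then F (first_part s) else 0.
Proof.
move=> m0; set p := first_part s => Ap.
have prefE d : (d %| m)%N ->
    prefix (nseq (m %/ d) d) s = (p == d) && (m %/ d <= run_length s)%N.
  by move=> dm; rewrite prefix_runE// divn_gt0 ?(dvdn_gt0 m0 dm)// dvdn_leq.
case: (boolP (p %| m)%N) => /= pm.
  rewrite (big_rem p) -?dvdn_divisors//= mem_set// prefE// eqxx /=.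
  rewrite big_seq_cond big1 ?addr0; first by case: ifP; rewrite ?mulr1 ?mulr0.
  move=> d /andP[]; rewrite mem_rem_uniq ?divisors_uniq// !inE => /andP[dp dm] _.
  by rewrite prefE ?dvdn_divisors// eq_sym (negbTE dp) mulr0.
rewrite big_seq_cond big1// => d /andP[]; rewrite -dvdn_divisors// => dm _.
rewrite prefE//; case: eqVneq => [pd|_]; last by rewrite mulr0.
by rewrite pd dm in pm.
Qed.

(** The sum over divisors appears here, for a single composition, because the
    double sum can then be exchanged with the sum over compositions. *)
Lemma run_total_pow (R : realType) (A : set nat) (n r : nat) (s : seq nat) :
  (0 < r)%N -> (0 < n)%N -> compositions A n s ->
  (run_total s)%:R ^+ r = \sum_(1 <= m < n.+1) \sum_(d <- divisors m | d \in A)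
    (m%:R ^+ r - (m%:R - d%:R) ^+ r) * (prefix (nseq (m %/ d) d) s)%:R :> R.
Proof.
move=> r0 n0 [[s_gt0 sn] sA].
have ps : first_part s \in s.
  by case: s sn {s_gt0 sA} => [|a s] /= sn; [rewrite -sn in n0|rewrite mem_head].
have p0 := s_gt0 _ ps; have Ap := sA _ ps.
have tot_le : (run_length s * first_part s <= n)%N.
  have : prefix (nseq (run_length s) (first_part s)) s by rewrite prefix_nseqE.
  by case/prefixP => t st; rewrite -sn {3}st sumn_cat sumn_nseq mulnC leq_addr.
rewrite big_add1 /=.
under eq_bigr => m _ do rewrite sum_divisors_prefix// -capped_pow_step//.
rewrite telescope_sumr// div0n min0n mul0n expr0n gtn_eqF//= subr0.
by rewrite (minn_idPr _) ?leq_divRL// /run_total mulnC.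
Qed.

Lemma run_total_moment (R : realType) (A : set nat) (n r : nat) :
  ~ A 0%N -> (0 < r)%N -> (0 < n)%N ->
  \sum_(s <- fset_set (compositions A n)) (run_total s)%:R ^+ r =
  \sum_(1 <= m < n.+1) divisor_sum R A r m * (ncomp A (n - m))%:R.
Proof.
move=> A0 r0 n0.
rewrite big_seq; under eq_bigr => s.
  by rewrite mem_compositions => /set_mem cs; rewrite (run_total_pow _ r0 n0 cs); over.
rewrite -big_seq exchange_big /=; apply: eq_big_nat => m /andP[m0 mn].
rewrite exchange_big /= /divisor_sum mulr_suml.
rewrite big_seq_cond [RHS]big_seq_cond; apply: eq_bigr => d /andP[dm /set_mem Ad].
have d0 : (0 < d)%N by case: d Ad {dm}.
have {}dm : (d %| m)%N by move: dm; rewrite -dvdn_divisors.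
rewrite -mulr_sumr -natr_sum; congr (_ * _%:R).
have := count_prefix (m %/ d) n Ad d0; rewrite divnK// -ltnS mn => <-.
by rewrite -sum1_count [RHS]big_mkcond; apply: eq_bigr => s _; case: ifP.
Qed.

Lemma divisor_sum_ge0 (R : realType) (A : set nat) r m :
  (0 < m)%N -> 0 <= divisor_sum R A r m.
Proof.
move=> m0; rewrite /divisor_sum big_seq_cond; apply: sumr_ge0 => d /andP[dm _].
have dm' : (d <= m)%N.
  by move: dm; rewrite -dvdn_divisors// => /dvdn_leq ->.
by rewrite -natrB// subr_ge0 lerXn2r ?nnegrE// ler_nat leq_subr.
Qed.

(** The term m = 0 is set to 0 because [divisors 0] is not empty. *)
Lemma comp_expect_cvg (R : realType) (A : set nat) (rho mu H : R) r :
  ~ A 0%N -> 0 < rho -> 0 < mu ->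
  (forall n, (ncomp A n)%:R * rho ^+ n <= 1) ->
  (ncomp A n)%:R * rho ^+ n @[n --> \oo] --> mu^-1 ->
  (0 < r)%N ->
  series (fun m => if m == 0%N then 0 else divisor_sum R A r m * rho ^+ m) @ \oo --> H ->
  comp_expect A n (fun s => (run_total s)%:R ^+ r : R) @[n --> \oo] --> H.
Proof.
move=> A0 rho0 mu0 u1 umu r0 hH; pose u n : R := (ncomp A n)%:R * rho ^+ n.
have u_norm n : `|u n| <= 1.
  by rewrite ger0_norm ?u1// mulr_ge0// exprn_ge0// ltW.
have h0 m : 0 <= (if m == 0%N then 0 else divisor_sum R A r m * rho ^+ m).
  by case: m => // m; rewrite mulr_ge0 ?divisor_sum_ge0// exprn_ge0// ltW.
have mu1 : mu^-1 != 0 by rewrite invr_eq0 gt_eqF.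
have shift k : u (n - k)%N @[n --> \oo] --> mu^-1.
  exact: (cvg_comp _ _ (cvg_subn_infty k cvg_id) umu).
have lim : (\sum_(0 <= k < n.+1)
      (if k == 0%N then 0 else divisor_sum R A r k * rho ^+ k) * u (n - k)%N) / u n
    @[n --> \oo] --> H.
  rewrite -(mulfK mu1 H); apply: cvgM; last exact: cvgV.
  exact: (convolution_cvg h0 hH u_norm cvg_id shift).
apply: cvg_trans lim; apply: near_eq_cvg; near=> n.
have n0 : (0 < n)%N by near: n; exact: nbhs_infty_ge.
rewrite /comp_expect run_total_moment// /u.
have rn0 : rho ^+ n != 0 by rewrite expf_neq0// gt_eqF.
have -> : \sum_(0 <= k < n.+1)
      (if k == 0%N then 0 else divisor_sum R A r k * rho ^+ k) *
      ((ncomp A (n - k))%:R * rho ^+ (n - k)) =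
    (\sum_(1 <= m < n.+1) divisor_sum R A r m * (ncomp A (n - m))%:R) * rho ^+ n.
  rewrite big_ltn//= mul0r add0r mulr_suml; apply: eq_big_nat => k /andP[k0 kn].
  by rewrite gtn_eqF// mulrACA -exprD subnKC.
by rewrite -mulf_div divff ?mulr1.
Unshelve. all: by end_near. Qed.

Lemma nneseries_finite_cvg (R : realType) (h : R^nat) :
  (forall k, 0 <= h k) -> h 0%N = 0 ->
  (\sum_(1 <= m <oo) (h m)%:E < +oo)%E ->
  exists2 H, series h @ \oo --> H & (\sum_(1 <= m <oo) (h m)%:E)%E = H%:E.
Proof.
move=> h0 h00 fin.
have partialE n : (\sum_(1 <= m < n) (h m)%:E)%E = (series h n)%:E.
  rewrite sumEFin /series /=; case: n => [|n]; first by rewrite !big_geq.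
  by rewrite [in RHS]big_ltn// h00 add0r.
have hfin : (\sum_(1 <= m <oo) (h m)%:E)%E \is a fin_num.
  by rewrite ge0_fin_numE//; apply: nneseries_ge0 => n _ _; rewrite lee_fin.
have cvgh : cvgn (series h).
  apply: nondecreasing_is_cvgn; first exact: nondecreasing_series.
  exists (fine (\sum_(1 <= m <oo) (h m)%:E)%E) => _ [n _ <-].
  rewrite -lee_fin fineK// -partialE.
  by apply: nneseries_lim_ge => k _ _; rewrite lee_fin.
exists (limn (series h)) => //.
apply/cvg_lim => //; under eq_fun do rewrite partialE.
by apply: cvg_EFin => //; exact: nearW.
Qed.

(** * Dominance of the zero rho *)

Section ComplexSeries.
Variable R : realType.
Implicit Types (z : R[i]) (x : R).

Lemma normc_realE x : `|x%:C| = `|x|%:C.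
Proof. by rewrite normc_def /= expr0n /= addr0 sqrtr_sqr. Qed.

Lemma cvg_Re (f : nat -> R[i]^o) z :
  f @ \oo --> (z : R[i]^o) -> complex.Re (f n) @[n --> \oo] --> (complex.Re z : R).
Proof.
move=> fz; apply/cvgrPdist_lt => e e0.
have eC : 0 < e%:C by rewrite ltcR.
move/cvgrPdist_lt : fz => /(_ _ eC); apply: filterS => n.
rewrite -ltcR; apply: le_lt_trans.
rewrite -(raddfB (@complex.Re R)); exact: normc_ge_Re.
Qed.

Lemma cvg_real_complex (u : nat -> R) x :
  u @ \oo --> x -> (fun n => (u n)%:C : R[i]^o) @ \oo --> (x%:C : R[i]^o).
Proof.
move=> ux; apply/cvgrPdist_lt => e e0.
have [e_im e_re] : complex.Im e = 0 /\ 0 < complex.Re e.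
  by move: e0; rewrite ltcE /= => /andP[/eqP].
have -> : e = (complex.Re e)%:C by apply/eqP; rewrite eq_complex /= eqxx e_im eqxx.
move/cvgrPdist_lt : ux => /(_ _ e_re); apply: filterS => n.
by rewrite -rmorphB normc_realE ltcR.
Qed.

Lemma B_real_complex (A : set nat) x : `|x| < 1 -> B A x%:C = (B A x)%:C.
Proof.
move=> x1; apply/cvg_lim; first exact: norm_hausdorff.
have -> : Bseries A x%:C = (fun n => (Bseries A x n)%:C : R[i]^o).
  apply/funext => n; rewrite /Bseries /series /= rmorph_sum /=.
  by apply: eq_bigr => k _; rewrite rmorphM rmorphXn rmorph_nat.
by apply: cvg_real_complex; exact: Bseries_cvg.
Qed.

Lemma eq_real_complex_of_norm z x : `|z| <= x%:C -> x <= complex.Re z -> z = x%:C.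
Proof.
move=> zx xz; have x0 : 0 <= x.
  by have := le_trans (normr_ge0 z) zx; rewrite lecE /= => /andP[].
have : (complex.Re z) ^+ 2 + (complex.Im z) ^+ 2 <= x ^+ 2.
  by rewrite -lecR add_Re2_Im2 rmorphXn lerXn2r// ?nnegrE// lecR.
move=> nz; have im0 : complex.Im z = 0 by apply/eqP; rewrite -sqrf_eq0; apply/eqP; nra.
by apply/eqP; rewrite eq_complex /= im0 eqxx andbT; apply/eqP; nra.
Qed.

(** The nonnegative terms rho^n - Re z^n, n in A, sum to 1 - 1 = 0, so all
    vanish; as |z^n| <= rho^n this gives z^n = rho^n. *)
Lemma B_eq1_small (A : set nat) (rho : R) z :
  (forall d : nat, (forall a, A a -> (d %| a)%N) -> d = 1%N) ->
  0 < rho < 1 -> B A rho = 1 -> cvgn (Bseries A z) ->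
  B A z = 1 -> `|z| <= rho%:C -> z = rho%:C.
Proof.
move=> A_gcd /andP[rho0 rho1] Brho cvgz Bz zrho.
have rho_norm : `|rho| < 1 by rewrite gtr0_norm.
have pow_le n : `|z ^+ n| <= (rho ^+ n)%:C.
  rewrite normrX rmorphXn; apply: lerXn2r => //; rewrite ?nnegrE//.
  by rewrite lecR ltW.
have Re_le n : complex.Re (z ^+ n) <= rho ^+ n.
  rewrite -lecR; apply: le_trans (pow_le n); apply: le_trans (normc_ge_Re _).
  by rewrite lecR ler_norm.
pose g n : R := (n \in A)%:R * (rho ^+ n - complex.Re (z ^+ n)).
have g0 n : 0 <= g n by rewrite mulr_ge0// subr_ge0.
have gS : series g @ \oo --> (0 : R).
  have -> : series g = (fun n => Bseries A rho n - complex.Re (Bseries A z n)).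
    apply/funext => n; rewrite /Bseries /series /= raddf_sum -sumrB.
    apply: eq_bigr => k _; rewrite /g mulrBr; congr (_ - _).
    by case: (k \in A); rewrite ?mul1r ?mul0r.
  rewrite -(subrr (1 : R)); apply: cvgB.
    by rewrite -Brho; exact: Bseries_cvg.
  by rewrite (_ : 1 = complex.Re (B A z)); [exact: cvg_Re|rewrite Bz].
have g_nd : nondecreasing_seq (series g) by apply: nondecreasing_series.
have gE n : g n = 0.
  apply/eqP; rewrite eq_le g0 andbT.
  have : series g n.+1 <= 0.
    rewrite -(cvg_lim _ gS)//; apply: nondecreasing_cvgn_le => //.
    by apply/cvg_ex; exists 0.
  apply: le_trans; rewrite /series /= big_nat_recr//= lerDr.
  exact: sumr_ge0.
suff : z ^+ 1 = rho%:C ^+ 1 by rewrite !expr1.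
have rhoC m : rho%:C ^+ m != 0 by rewrite -rmorphXn fmorph_eq0 expf_neq0// gt_eqF.
apply: (gcd1_diff_closed (G := [set m | z ^+ m = rho%:C ^+ m]) A_gcd).
- move=> a Aa /=; rewrite -rmorphXn; apply: eq_real_complex_of_norm => //.
  by have := gE a; rewrite /g mem_set// mul1r => /eqP; rewrite subr_eq0 => /eqP ->.
- by move=> m n /= zm zn; rewrite !exprD zm zn.
- by move=> m n /= zm; rewrite !exprD zm => /(mulfI (rhoC m)).
Qed.

Lemma B_unique_dominant_zero (A : set nat) (rho rad : R) :
  (forall d : nat, (forall a, A a -> (d %| a)%N) -> d = 1%N) ->
  0 < rho < 1 -> rho < rad -> B A rho = 1 ->
  (forall z, `|z| < rad%:C -> cvgn (Bseries A z)) ->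
  unique_dominant_zero [set z : R[i] | `|z| < rad%:C] (fun z => 1 - B A z) rho%:C.
Proof.
move=> A_gcd rho01 rho_rad Brho B_cvg; have /andP[rho0 rho1] := rho01.
have normE : `|rho%:C| = rho%:C by rewrite normc_realE gtr0_norm.
split.
- by rewrite /= normE ltcR.
- by rewrite B_real_complex ?Brho ?subrr// gtr0_norm.
move=> z /= zrad /eqP; rewrite subr_eq0 => /eqP/esym Bz zrho.
rewrite real_ltNge ?normr_real// normE; apply/negP => zle.
by apply: zrho; exact: B_eq1_small (B_cvg z zrad) Bz zle.
Qed.

End ComplexSeries.

(** * The limit theorem *)

Theorem proposition9p2 (R : realType) (A : set nat) (rho rad : R)
  (A_pos : forall a, A a -> (0 < a)%N)
  (A_neq0 : A !=set0)
  (rho01 : 0 < rho < 1)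
  (rho_rad : rho < rad)
  (B_cvg : forall z : R[i], `|z| < rad%:C -> cvgn (Bseries A z))
  (B_analytic : forall z : R[i], `|z| < rad%:C -> analytic_at (B A) z)
  (B_rho : B A rho = 1)
  (A_gcd : forall d : nat, (forall a, A a -> (d %| a)%N) -> d = 1%N) :
  [/\ unique_dominant_zero [set z : R[i] | `|z| < rad%:C]
        (fun z => 1 - B A z) rho%:C,
      (fun n => (ncomp A n)%:R : R) ~_\oo
        (fun n => rho ^- n.+1 / derive1 (B A : R -> R) rho),
      (forall p k : nat, A p -> (1 <= k)%N ->
        comp_prob R A n [set s | first_part s = p /\ run_length s = k]
          @[n --> \oo] --> rho ^+ (p * k) * (1 - rho ^+ p)),
      [/\ limit_prob R A setT = 1%E,
          (forall p : nat, A p ->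
            limit_prob R A [set x | x.1 = p] = (rho ^+ p)%:E),
          (forall k : nat, (1 <= k)%N ->
            limit_prob R A [set x | (k <= x.2)%N] = (B A (rho ^+ k))%:E) &
          (forall s : nat, (1 <= s)%N ->
            limit_prob R A [set x | (x.1 * x.2)%N = s] =
            (rho ^+ s * \sum_(d <- divisors s | d \in A) (1 - rho ^+ d))%:E)] &
      forall r : nat, (1 <= r)%N ->
        (\sum_(1 <= m <oo) (divisor_sum R A r m * rho ^+ m)%:E < +oo)%E ->
        (comp_expect A n (fun s => (run_total s)%:R ^+ r : R))%:E
          @[n --> \oo] -->
        (\sum_(1 <= m <oo) (divisor_sum R A r m * rho ^+ m)%:E)%E].
Proof.
have A0 : ~ A 0%N by move=> /A_pos.
have /andP[rho0 rho1] := rho01.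
have [u_le1 mu0 u_cvg] := ncomp_asymptotics A0 rho01 B_rho A_gcd.
have initial_run p k : A p -> (0 < k)%N ->
    comp_prob R A n [set s | first_part s = p /\ run_length s = k]
      @[n --> \oo] --> rho ^+ (p * k) * (1 - rho ^+ p).
  exact: comp_prob_initial_run_cvg A0 rho0 mu0 u_cvg.
have pmfE p k : A p -> (0 < k)%N ->
    limit_pmf R A p k = rho ^+ (p * k) * (1 - rho ^+ p).
  by move=> Ap k0; apply/cvg_lim => //; exact: initial_run.
split.
- exact: B_unique_dominant_zero.
- have -> : (fun n => rho ^- n.+1 / derive1 (B A : R -> R) rho) =
      (fun n => rho ^- n / (rho * derive1 (B A : R -> R) rho)).
    by apply/funext => n; rewrite exprSr !invfM mulrA.
  exact: equiv_of_weighted_cvg.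
- exact: initial_run.
- split.
  + by rewrite (limit_prob_setT A0 rho01 pmfE) B_rho.
  + exact: (limit_prob_part A0 rho01 pmfE).
  + exact: (limit_prob_run_ge A0 rho01 pmfE).
  + exact: (limit_prob_total A0 rho01 pmfE).
- move=> r r0 fin.
  pose h m : R := if m == 0%N then 0 else divisor_sum R A r m * rho ^+ m.
  have h0 m : 0 <= h m.
    by case: m => // m; rewrite /h /= mulr_ge0 ?divisor_sum_ge0// exprn_ge0// ltW.
  have hE : (\sum_(1 <= m <oo) (divisor_sum R A r m * rho ^+ m)%:E =
             \sum_(1 <= m <oo) (h m)%:E)%E.
    congr (limn _); apply/funext => n; apply: eq_big_nat => m /andP[m0 _].
    by rewrite /h gtn_eqF.
  rewrite hE in fin *.
  have [H hH ->] := nneseries_finite_cvg h0 erefl fin.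
  apply: cvg_EFin; first exact: nearW.
  exact: comp_expect_cvg A0 rho0 mu0 u_le1 u_cvg r0 hH.
Qed.
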